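(* Let $d\ge1$ and let $E:[0,\infty)\to\mathbb R\cup\{\infty\}$ be lower semi-continuous and convex with $E(0)=0$, twice continuously differentiable on the interior of its domain $D(E)=\{c\ge0:E(c)<\infty\}$. Let $N_E(\rho,\gamma)=(\rho/\gamma)^dE(\gamma^{d+2}/\rho^d)$ for $\rho,\gamma>0$. Assume that $N_E:(0,\infty)^2\to\mathbb R\cup\{\infty\}$ is convex and that $\rho\mapsto(d-1)N_E(\rho,\gamma)$ is non-increasing on $(0,\infty)$ for every $\gamma>0$ (void for $d=1$). Then the following three conditions, which are equivalent to each other, hold: (A) the function $(0,\infty)\ni c\mapsto c^{-2/(d+2)}E(c)$ is non-decreasing; (B) for all $\rho,\gamma>0$ (with $\gamma^{d+2}/\rho^d$ in the interior of $D(E)$) we have $\big(1-\frac4{d^2}\big)\rho\,\partial_\rho N_E(\rho,\gamma)+\gamma\,\partial_\gamma N_E(\rho,\gamma)\ge0$; (C) for all $\rho,\gamma>0$ the mapping $(0,\infty)\ni s\mapsto N_E(s^{1-4/d^2}\rho,s\gamma)$ is non-decreasing.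
   Context: The convexity/monotonicity hypothesis on $N_E$ is equivalent to: for all $c$ in the interior of $D(E)$, with $\varepsilon_0=E(c)$, $\varepsilon_1=cE'(c)$, $\varepsilon_2=c^2E''(c)$, one has $(d-1)(\varepsilon_1-\varepsilon_0)\ge0$ and the symmetric matrix with entries $\mathbb B_{11}=\varepsilon_2-\frac{d-1}d(\varepsilon_1-\varepsilon_0)$, $\mathbb B_{12}=\mathbb B_{21}=\varepsilon_2-\frac12(\varepsilon_1-\varepsilon_0)$, $\mathbb B_{22}=\varepsilon_2+\frac12\varepsilon_1$ is positive semi-definite. *)

(* Defs.v *)
From HB Require Import structures.
From mathcomp Require Export all_boot all_order all_algebra.
From mathcomp Require Export all_classical all_reals all_analysis.

Set Implicit Arguments.
Unset Strict Implicit.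
Unset Printing Implicit Defensive.

Import Order.TTheory GRing.Theory Num.Theory.
Import numFieldNormedType.Exports.

Local Open Scope ring_scope.
Local Open Scope classical_set_scope.

(* A function with values in R u {+oo}, on a subset A of V, is represented by a
   function V -> \bar R which is never -oo on A; its values outside A are
   irrelevant. *)
Definition never_ninfty {R : realType} {V : Type} (A : set V) (f : V -> \bar R) :=
  forall x, A x -> f x != -oo%E.

(* To be used together with [never_ninfty A f], so that oo - oo does not occur;
   the convention 0 * +oo = 0 makes the cases t = 0 and t = 1 harmless. *)
Definition econvex_on {R : realType} {V : lmodType R} (A : set V)
    (f : V -> \bar R) :=
  forall x y (t : R), A x -> A y -> 0 <= t <= 1 ->
    (f ((1 - t) *: x + t *: y)%R <= (1 - t)%:E * f x + t%:E * f y)%E.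

Definition halfline {R : realType} : set R := [set c | 0 <= c].

Definition quadrant {R : realType} : set (R^o * R^o)%type :=
  [set p | 0 < p.1 /\ 0 < p.2].

Definition dom {R : realType} (E : R -> \bar R) : set R :=
  [set c | 0 <= c /\ (E c < +oo)%E].

Definition C2_on {R : realType} (U : set R) (f : R -> R) :=
  forall c, U c -> [/\ derivable f c 1, derivable (f^`()) c 1
                     & {for c, continuous (f^`()^`())}].

(* The interior of [dom E] is taken in R, so it never contains 0.
   [subspace halfline] is [0, +oo[ with its relative topology, the remaining
   reals being isolated points: lower semicontinuity there says nothing about
   E outside [0, +oo[. *)
Definition energy_density {R : realType} (E : R -> \bar R) :=
  [/\ never_ninfty halfline E,
      @lower_semicontinuous (subspace (@halfline R)) R E,
      econvex_on (V := R^o) halfline E,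
      E 0 = 0%E
    & C2_on (dom E)° (fine \o E)].

Definition N_ {R : realType} (d : R) (E : R -> \bar R) (rho gamma : R) : \bar R :=
  (((rho / gamma) `^ d)%:E * E (gamma `^ (d + 2) / rho `^ d)%R)%E.

Definition enondecreasing_pos {R : realType} (f : R -> \bar R) :=
  forall x y : R, 0 < x -> x <= y -> (f x <= f y)%E.

Definition enonincreasing_pos {R : realType} (f : R -> \bar R) :=
  forall x y : R, 0 < x -> x <= y -> (f y <= f x)%E.

Definition condA {R : realType} (d : R) (E : R -> \bar R) :=
  enondecreasing_pos (fun c => ((c `^ (- (2 / (d + 2))))%:E * E c)%E).

(* The partial derivatives are those of the real-valued function [fine \o N_ d E],
   which is differentiable at the points considered when [energy_density E]. *)
Definition condB {R : realType} (d : R) (E : R -> \bar R) :=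
  forall rho gamma : R, 0 < rho -> 0 < gamma ->
    (dom E)° (gamma `^ (d + 2) / rho `^ d) ->
    0 <= (1 - 4 / d ^+ 2) * rho * derive1 (fun r => fine (N_ d E r gamma)) rho
         + gamma * derive1 (fun g => fine (N_ d E rho g)) gamma.

Definition condC {R : realType} (d : R) (E : R -> \bar R) :=
  forall rho gamma : R, 0 < rho -> 0 < gamma ->
    enondecreasing_pos
      (fun s => N_ d E (s `^ (1 - 4 / d ^+ 2) * rho) (s * gamma)).

(* Main.v *)
Require Import Defs.
From mathcomp Require Import ring lra.
Set Implicit Arguments.
Unset Strict Implicit.
Unset Printing Implicit Defensive.
Import Order.TTheory GRing.Theory Num.Theory.
Import numFieldNormedType.Exports.
Local Open Scope ring_scope.
Local Open Scope classical_set_scope.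

(** Write al = 2 / (d + 2).  All three conditions say the same thing about the
    slope of E, namely

      al * E c <= c * E' c   for every c in the interior of the domain.

    For (A) this is the sign of the derivative of c^(-al) * E c [slope_geP].
    The one delicate point is a right endpoint y of the domain with E y finite,
    where E has no derivative: there convexity bounds E between a point x < y
    and y by the chord, which tends to E y, so that monotonicity up to y
    survives.  For (B) it is the chain rule [condB_slope_ge]: the stated
    combination of partial derivatives of N is a positive multiple of
    c * E' c - al * E c.  For (C) no derivative is needed: along the curve
    s |-> (s^(1 - 4/d^2) rho, s gamma) the argument c of E is a constant
    times s^(2 + 4/d), and N is a constant times c^(-al) * E c [N_ray], so
    (C) is (A) after an increasing change of variable [condA_condC].

    It remains to derive the slope inequality from the convexity of N.  In the
    matrix of second derivatives it is the entry in the direction that is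
    tangent to the level curve of c = gamma^(d+2) / rho^d, since E'' does not
    contribute there.  To use only the first derivative of E, take two points
    of the level curve,

      (e^((d+2)h), g e^(dh))  and  (e^(-(d+2)h), g e^(-dh)),

    and compare N at their midpoint with the mean of its values
    [N_midpoint].  At the midpoint the argument of E is c * r, with r within
    O(h^2) of 1, and E (c * r) >= E c + c * E' c * (r - 1) by convexity
    [tangent_le].  All the coefficients are powers of hyperbolic cosines, so
    dividing by h^2 and letting h tend to 0 gives
    d * (d + 2) * c * E' c - 2 * d * E c >= 0 [econvex_N_slope_ge]. *)

(** * Derivatives *)

Lemma is_derive_ge0_right (R : realType) (f : R -> R) (x a : R) :
  is_derive x 1 f a -> (\forall z \near x^'+, f x <= f z) -> 0 <= a.
Proof.
move=> /is_derive1_caratheodory[g [fE gc gx]] fz.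
apply: (@cvgr_to_ge _ (x^'+) _ _ g).
  by rewrite -gx; apply: cvg_at_right_filter; exact: gc.
near=> z.
have xz : 0 < z - x by rewrite subr_gt0; near: z; exact: nbhs_right_gt.
rewrite -(pmulr_lge0 _ xz) -fE subr_ge0.
by near: z.
Unshelve. all: by end_near. Qed.

(** The factor x ^ (p - 1) is written x ^ p / x, so that later identities
    between derivatives are rational in the powers that occur. *)
Lemma is_derive_powR_gt0 (R : realType) (p x : R) : 0 < x ->
  is_derive x 1 (fun y => y `^ p) (p * x `^ p / x).
Proof.
move=> x0.
have -> : p * x `^ p / x = p * x `^ (p - 1).
  by rewrite -mulrA -{2}[x]powRr1 ?(ltW x0)// -powRB // (gt_eqF x0) implybT.
exact: is_derive1_powR.
Qed.

(** Infinite values need no exclusion because [fine] sends them to 0, and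
    0 * +oo = 0. *)
Lemma fineZ (R : realType) (a : R) (x : \bar R) :
  fine (a%:E * x)%E = a * fine x.
Proof.
case: x => [r| |] //=; rewrite /mule/= eqe; case: ifPn => _ /=;
  rewrite ?mulr0//; case: ifPn => _ /=; rewrite ?mulr0//.
Qed.

(** * Second-order expansions at 0 *)

(** The expansion u h = 1 + a h^2 + o(h^2), stated as a limit: a is half the
    second derivative of an even function u at 0. *)
Definition quad_cvg {R : realType} (u : R -> R) (a : R) :=
  (fun h => (u h - 1) / h ^+ 2) @ 0^' --> a.

Lemma quad_cvg_cvg1 (R : realType) (u : R -> R) (a : R) :
  quad_cvg u a -> u @ 0^' --> (1 : R).
Proof.
move=> ua.
have h0 : (fun h : R => h ^+ 2) @ 0^' --> (0 : R).
  have : (fun h : R => h ^+ 2) @ 0 --> (0 : R) ^+ 2 by exact: exprn_continuous.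
  rewrite expr0n/= => /cvg_within_filter; exact.
have : (fun h => 1 + (u h - 1) / h ^+ 2 * h ^+ 2) @ 0^' --> (1 + a * 0 : R).
  by apply: cvgD; [exact: cvg_cst|exact: cvgM].
rewrite mulr0 addr0; apply: cvg_trans; apply: near_eq_cvg.
near=> h => /=.
have hn0 : h != 0 by near: h; exact: nbhs_dnbhs_neq.
by rewrite divfK ?expf_neq0// addrC subrK.
Unshelve. all: by end_near. Qed.

(** Only the first derivative of f enters, as u h - 1 is itself of order h^2.
    The factorization f x - 1 = g x * (x - 1) with g continuous at 1 covers
    the points where u h = 1. *)
Lemma quad_cvg_comp (R : realType) (f u : R -> R) (a b : R) :
  f 1 = 1 -> is_derive (1 : R) 1 f b -> quad_cvg u a -> quad_cvg (f \o u) (b * a).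
Proof.
move=> f1 /is_derive1_caratheodory[g [fE gc gx]] ua.
rewrite /quad_cvg; under eq_fun do rewrite /= -f1 fE -mulrA.
apply: cvgM; last exact: ua.
by rewrite -gx; apply: continuous_cvg => //; exact: quad_cvg_cvg1 ua.
Qed.

(** This comes from u v - 1 = (u - 1) v + (v - 1), in which v tends to 1. *)
Lemma quad_cvgM (R : realType) (u v : R -> R) (a b : R) :
  quad_cvg u a -> quad_cvg v b -> quad_cvg (u \* v) (a + b).
Proof.
move=> ua vb.
have -> : a + b = a * 1 + b by rewrite mulr1.
have : (fun h => (u h - 1) / h ^+ 2 * v h + (v h - 1) / h ^+ 2) @ 0^'
    --> (a * 1 + b : R).
  by apply: cvgD => //; apply: cvgM => //; exact: quad_cvg_cvg1 vb.
apply: cvg_trans; apply: near_eq_cvg.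
near=> h => /=.
ring.
Unshelve. all: by end_near. Qed.

Definition cosh {R : realType} (x : R) := (expR x + expR (- x)) / 2.

Lemma cosh_gt0 (R : realType) (x : R) : 0 < cosh x.
Proof. by rewrite divr_gt0// addr_gt0// expR_gt0. Qed.

(** The identity cosh (p h) - 1 = (e^(p h / 2) - e^(- p h / 2))^2 / 2 reduces
    this to a first derivative at 0. *)
Lemma quad_cvg_cosh (R : realType) (p : R) :
  quad_cvg (fun h => cosh (p * h)) (p ^+ 2 / 2).
Proof.
pose k (h : R) := expR (p / 2 * h) - expR (- (p / 2) * h).
have /is_derive1_caratheodory[g [kE gc g0]] : is_derive (0 : R) 1 k p.
  rewrite /k; apply: is_derive_eq.
  rewrite !mulr0 !expR0 !scaler1. 
  by field.
rewrite /quad_cvg.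
have : (fun h => g h ^+ 2 / 2) @ 0^' --> p ^+ 2 / 2.
  apply: cvgM; last exact: cvg_cst.
  have : g h @[h --> 0^'] --> p by rewrite -g0; apply: cvg_within_filter.
  by move=> gp; rewrite !expr2; apply: cvgM.
move=> uv; apply: cvg_trans uv; apply: near_eq_cvg; near=> h => /=.
have hn0 : h != 0 by near: h; exact: nbhs_dnbhs_neq.
have k0 : k 0 = 0 by rewrite /k !mulr0 subrr.
have := kE h; rewrite k0 !subr0 => kh.
have -> : g h = k h / h by rewrite kh mulfK.
rewrite /k /cosh.
have -> : p * h = p / 2 * h + p / 2 * h by field.
rewrite opprD mulNr !expRD.
have : expR (p / 2 * h) * expR (- (p / 2 * h)) = 1 by rewrite expRN divff// expR_eq0.
move: (expR (p / 2 * h)) (expR (- _)) => x y xy.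
rewrite [X in _ = X / _](_ : _ = (x * x + y * y) / 2 - x * y); last by rewrite xy.
by field.
Unshelve. all: by end_near. Qed.

(** * Convexity of the energy density *)

Lemma dom_fineK (R : realType) (E : R -> \bar R) (c : R) :
  energy_density E -> dom E c -> (fine (E c))%:E = E c.
Proof.
move=> [nN _ _ _ _] [c0 cfin]; apply: fineK.
by rewrite fin_real// ltNye nN.
Qed.

Lemma dom_convex (R : realType) (E : R -> \bar R) (x y t : R) :
  energy_density E -> dom E x -> dom E y -> 0 <= t <= 1 ->
  dom E ((1 - t) * x + t * y) /\
  fine (E ((1 - t) * x + t * y)) <= (1 - t) * fine (E x) + t * fine (E y).
Proof.
move=> hE dx dy /andP[t0 t1].
have [x0 _] := dx; have [y0 _] := dy.
have z0 : 0 <= (1 - t) * x + t * y.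
  by rewrite addr_ge0// mulr_ge0// subr_ge0.
have [_ _ cE _ _] := hE.
have := cE x y t x0 y0; rewrite t0 t1 => /(_ isT).
rewrite -(dom_fineK hE dx) -(dom_fineK hE dy) -!EFinM -EFinD => le.
have dz : dom E ((1 - t) * x + t * y).
  by split=> //; apply: le_lt_trans le _; exact: ltry.
by split=> //; move: le; rewrite -[X in (X <= _)%E](dom_fineK hE dz) lee_fin.
Qed.

(** The domain is an interval starting at 0, because E 0 = 0 is finite. *)
Lemma dom_le (R : realType) (E : R -> \bar R) (x y : R) :
  energy_density E -> dom E y -> 0 <= x -> x <= y -> dom E x.
Proof.
move=> hE dy x0 xy.
have d0 : dom E 0 by have [_ _ _ E0 _] := hE; split; rewrite // E0 ltry.
have [y0|y0] := leP y 0.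
  by have -> : x = 0 by apply/eqP; rewrite eq_le x0 (le_trans xy).
have t01 : 0 <= x / y <= 1 by rewrite divr_ge0 ?(ltW y0)//= ler_pdivrMr// mul1r.
have [+ _] := dom_convex hE d0 dy t01.
by rewrite mulr0 add0r divfK// gt_eqF.
Qed.

Lemma dom_interior (R : realType) (E : R -> \bar R) (x y : R) :
  energy_density E -> dom E y -> 0 < x -> x < y -> (dom E)° x.
Proof.
move=> hE dy x0 xy.
have xi : x \in `]0, y[%R by rewrite in_itv/= x0.
apply: filterS (near_in_itvoo xi) => z; rewrite in_itv/= => /andP[z0 zy].
by apply: (dom_le hE dy); exact: ltW.
Qed.

Lemma interior_dom_gt0 (R : realType) (E : R -> \bar R) (c : R) :
  (dom E)° c -> 0 < c.
Proof.
move=> /nbhs_ballP[e /= e0 ce].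
have [+ _] : dom E (c - e / 2).
  apply: ce; rewrite /ball/= opprB addrC subrK gtr0_norm ?divr_gt0//.
  by rewrite ltr_pdivrMr// ltr_pMr// ltr1n.
by rewrite subr_ge0; apply: lt_le_trans; rewrite divr_gt0.
Qed.

Lemma is_derive_fineE (R : realType) (E : R -> \bar R) (c : R) :
  energy_density E -> (dom E)° c ->
  is_derive c 1 (fine \o E) (derive1 (fine \o E) c).
Proof.
move=> [_ _ _ _ C2] /C2[dE _ _].
by rewrite derive1E; exact/derivableP.
Qed.

(** By convexity the difference between the chord from c to x and E is
    nonnegative on the segment and vanishes at c, so its right derivative
    there, E x - E c - E' c * (x - c), is nonnegative. *)
Lemma tangent_le (R : realType) (E : R -> \bar R) (c x : R) :
  energy_density E -> (dom E)° c -> dom E x ->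
  fine (E c) + derive1 (fine \o E) c * (x - c) <= fine (E x).
Proof.
move=> hE ic dx; have dc := interior_subset ic.
pose k t := fine (E c) + t * (fine (E x) - fine (E c))
  - (fine \o E) (c + t * (x - c)).
have df : is_derive (c + 0 * (x - c)) 1 (fine \o E) (derive1 (fine \o E) c).
  by rewrite mul0r addr0; exact: is_derive_fineE.
have dk : is_derive (0 : R) 1 k
    (fine (E x) - fine (E c) - derive1 (fine \o E) c * (x - c)).
  have dl : is_derive (0 : R) 1 (fun t => c + t * (x - c)) (x - c).
    by apply: is_derive_eq; rewrite /GRing.scale/=; ring.
  have dfl := @is_derive1_comp _ (fine \o E) (fun t => c + t * (x - c)) 0 _ _ df dl.
  have dm : is_derive (0 : R) 1 (fun t => fine (E c) + t * (fine (E x) - fine (E c)))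
      (fine (E x) - fine (E c)).
    by apply: is_derive_eq; rewrite /GRing.scale/=; ring.
  exact: is_deriveB dm dfl.
have := is_derive_ge0_right dk.
rewrite -addrA -opprD subr_ge0; apply.
near=> t.
have t0 : 0 <= t by near: t; exact: nbhs_right_ge.
have t1 : t <= 1 by near: t; apply: nbhs_right_le; exact: ltr01.
have [_] := dom_convex hE dc dx (introT andP (conj t0 t1)).
rewrite /k/= !mul0r !addr0 subrr subr_ge0.
by congr (fine (E _) <= _); ring.
Unshelve. all: by end_near. Qed.

(** * Condition (A) as a slope inequality *)

Definition slope_ge {R : realType} (al : R) (E : R -> \bar R) :=
  forall c, (dom E)° c -> al * fine (E c) <= c * derive1 (fine \o E) c.

Lemma is_derive_powRZ_fineE (R : realType) (al : R) (E : R -> \bar R) (c : R) :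
  energy_density E -> (dom E)° c ->
  is_derive c 1 (fun z => z `^ (- al) * fine (E z))
    (c `^ (- al) / c * (c * derive1 (fine \o E) c - al * fine (E c))).
Proof.
move=> hE ic; have c0 := interior_dom_gt0 ic.
have dp := is_derive_powR_gt0 (- al) c0.
have dE := is_derive_fineE hE ic.
have dM : is_derive c 1 (fun z => z `^ (- al) * fine (E z)) _ := is_deriveM dp dE.
apply: (is_derive_eq dM).
rewrite /= /GRing.scale/=; field.
by rewrite gt_eqF.
Qed.

(** Inside the domain this is the link between monotonicity and the sign of
    the derivative.  If y is the right endpoint of the domain and E y is finite,
    then c^(-al) * E c is non-decreasing below y and dominated by c^(-al) times the
    chord of E over [x, y], which takes the right value at y and is
    continuous. *)
Lemma slope_geP (R : realType) (al : R) (E : R -> \bar R) :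
  energy_density E ->
  enondecreasing_pos (fun c => (c `^ (- al))%:E * E c)%E <-> slope_ge al E.
Proof.
move=> hE; split => [mono c ic|sl].
  have c0 := interior_dom_gt0 ic.
  have := is_derive_ge0_right (is_derive_powRZ_fineE al hE ic).
  rewrite pmulr_rge0 ?divr_gt0 ?powR_gt0// subr_ge0; apply.
  near=> z.
  have cz : c <= z by near: z; exact: nbhs_right_ge.
  have dz : dom E z by near: z; apply: cvg_within; exact: ic.
  have := mono c z c0 cz.
  by rewrite -(dom_fineK hE dz) -(dom_fineK hE (interior_subset ic)) -!EFinM lee_fin.
pose g z := z `^ (- al) * fine (E z).
have gmono x y : 0 < x -> x <= y -> (dom E)° y -> g x <= g y.
  move=> x0 xy iy; have dy := interior_subset iy.
  have dg z : z \in `[x, y]%R -> (dom E)° z.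
    rewrite in_itv/= => /andP[xz]; rewrite le_eqVlt => /predU1P[->//|zy].
    by apply: dom_interior dy _ zy => //; exact: lt_le_trans xz.
  have dg' z : z \in `]x, y[%R -> (dom E)° z by move=> /subset_itv_oo_cc/dg.
  apply: (@ger0_derive1_ndecr _ g x y) => //.
  - by move=> z /dg' /(is_derive_powRZ_fineE al hE)[].
  - move=> z /dg' iz; rewrite derive1E.
    have /@derive_val -> := is_derive_powRZ_fineE al hE iz.
    rewrite pmulr_rge0 ?subr_ge0 ?sl// divr_gt0 ?powR_gt0//;
      exact: interior_dom_gt0 iz.
  - apply: derivable_within_continuous => z /dg.
    by move=> /(is_derive_powRZ_fineE al hE)[].
move=> x y x0 xy; have y0 := lt_le_trans x0 xy.
have [Ey|] := ltP (E y) +oo%E; last first.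
  by rewrite leye_eq => /eqP ->; rewrite gt0_muley ?lte_fin ?powR_gt0// leey.
have dy : dom E y by split=> //; exact: ltW.
have dx := dom_le hE dy (ltW x0) xy.
rewrite -(dom_fineK hE dy) -(dom_fineK hE dx) -!EFinM lee_fin.
move: xy; rewrite le_eqVlt => /predU1P[->//|xy].
(* the upper bound of c^(-al) * E c given by the chord over [x, y] *)
pose k z := z `^ (- al) *
  (fine (E x) + (z - x) / (y - x) * (fine (E y) - fine (E x))).
have -> : y `^ (- al) * fine (E y) = k y.
  by rewrite /k divff ?subr_eq0 ?gt_eqF// mul1r addrC subrK.
apply: (@cvgr_to_ge _ (y^'-) _ _ k).
  apply: cvg_at_left_filter.
  have [dp _] := is_derive_powR_gt0 (- al) y0.
  have dl : derivable (fun z => fine (E x) +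
      (z - x) / (y - x) * (fine (E y) - fine (E x))) y 1 by [].
  have : derivable k y 1 := derivableM dp dl.
  by move=> /derivable1_diffP/differentiable_continuous; exact.
near=> z.
have zy : z < y by near: z; exact: nbhs_left_lt.
have xz : x < z by near: z; exact: nbhs_left_gt.
have z0 := lt_trans x0 xz.
apply: le_trans (gmono x z x0 (ltW xz) (dom_interior hE dy z0 zy)) _.
rewrite /g /k ler_pM2l ?powR_gt0//.
have yx : 0 < y - x by rewrite subr_gt0.
pose t := (z - x) / (y - x).
have t01 : 0 <= t <= 1.
  rewrite divr_ge0 ?subr_ge0 ?(ltW xz) ?(ltW xy)//=.
  by rewrite ler_pdivrMr// mul1r lerB// ltW.
have [_] := dom_convex hE dx dy t01.
have -> : (1 - t) * x + t * y = z by rewrite /t; field; rewrite gt_eqF.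
by move/le_trans; apply; rewrite -/t; lra.
Unshelve. all: by end_near. Qed.

(** * Condition (C) *)

Lemma powR_expR (R : realType) (x p : R) : expR x `^ p = expR (p * x).
Proof. by rewrite /powR gt_eqF ?expR_gt0// expRK. Qed.

(** The exponent 1 - 4 / d^2 is the one for which the prefactor
    (rho / gamma)^d becomes a power of c with exponent - 2 / (d + 2).  Writing
    the positive quantities as exponentials turns the identity into linear
    algebra on the exponents. *)
Lemma N_ray (R : realType) (d : R) (E : R -> \bar R) (rho gamma s : R) :
  0 < d -> 0 < rho -> 0 < gamma -> 0 < s ->
  let c0 := gamma `^ (d + 2) / rho `^ d in
  let c := c0 * s `^ (2 + 4 / d) in
  N_ d E (s `^ (1 - 4 / d ^+ 2) * rho) (s * gamma) =
  (((rho / gamma) `^ d * c0 `^ (2 / (d + 2)))%:E *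
   ((c `^ (- (2 / (d + 2))))%:E * E c))%E.
Proof.
move=> d0 r0 g0 s0 c0 c; rewrite /N_ muleA -EFinM /c /c0 {c c0}.
rewrite -(lnK r0) -(lnK g0) -(lnK s0).
move: (ln rho) (ln gamma) (ln s) => r g t.
rewrite !(powR_expR, =^~ expRD, =^~ expRN).
congr (_%:E * E _)%E; congr expR; field.
  by rewrite gt_eqF//= gt_eqF// addr_gt0.
by rewrite gt_eqF.
Qed.

Lemma condA_condC (R : realType) (d : R) (E : R -> \bar R) :
  0 < d -> condA d E <-> condC d E.
Proof.
move=> d0; have q0 : 0 < 2 + 4 / d by rewrite addr_gt0 ?divr_gt0.
split=> [A rho gamma r0 g0 s t s0 st|C x y x0 xy].
  have t0 := lt_le_trans s0 st.
  rewrite /= (N_ray E d0 r0 g0 s0) (N_ray E d0 r0 g0 t0).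
  apply: lee_wpmul2l; first by rewrite lee_fin mulr_ge0 ?powR_ge0.
  apply: A; first by rewrite !mulr_gt0 ?invr_gt0 ?powR_gt0.
  rewrite ler_pM2l ?divr_gt0 ?powR_gt0//.
  by apply: ge0_ler_powR; rewrite ?nnegrE ?(ltW q0) ?(ltW s0) ?(ltW t0).
have y0 := lt_le_trans x0 xy.
pose q := 2 + 4 / d.
have key z : 0 < z -> ((z `^ (- (2 / (d + 2))))%:E * E z)%E =
    N_ d E ((z `^ q^-1) `^ (1 - 4 / d ^+ 2) * 1) (z `^ q^-1 * 1).
  move=> z0; rewrite (N_ray E d0 ltr01 ltr01 (powR_gt0 _ z0)) !powR1 /= !divr1 !powR1 /= !mul1r mul1e.
  by rewrite -/q -[(_ `^ q^-1) `^ q]powRrM mulVf ?gt_eqF// powRr1 ?ltW.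
rewrite (key x x0) (key y y0).
apply: (C 1 1 ltr01 ltr01 (x `^ q^-1) (y `^ q^-1)); first exact: powR_gt0.
by apply: ge0_ler_powR; rewrite ?nnegrE ?invr_ge0 ?(ltW q0) ?(ltW x0) ?(ltW y0).
Qed.

(** * Condition (B) *)

Lemma N_gradient (R : realType) (d : R) (E : R -> \bar R) (rho gamma : R) :
  energy_density E -> 0 < rho -> 0 < gamma ->
  let c := gamma `^ (d + 2) / rho `^ d in (dom E)° c ->
  let e0 := fine (E c) in let e1 := c * derive1 (fine \o E) c in
  rho * derive1 (fun r => fine (N_ d E r gamma)) rho =
    (rho / gamma) `^ d * (d * (e0 - e1)) /\
  gamma * derive1 (fun g => fine (N_ d E rho g)) gamma =
    (rho / gamma) `^ d * ((d + 2) * e1 - d * e0).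
Proof.
move=> hE r0 g0 c ic e0 e1.
have dE := is_derive_fineE hE ic.
have rg0 : 0 < rho / gamma by rewrite divr_gt0.
split.
  have -> : (fun r => fine (N_ d E r gamma)) =
      (fun r => (r / gamma) `^ d * (fine \o E) (gamma `^ (d + 2) * r `^ (- d))).
    by apply/funext => r; rewrite fineZ powRN.
  have du : is_derive rho 1 (fun r => r / gamma) gamma^-1.
    by apply: is_derive_eq; rewrite /GRing.scale/=; ring.
  have dv : is_derive rho 1 (fun r => gamma `^ (d + 2) * r `^ (- d))
      (- d * c / rho).
    have := is_derive_powR_gt0 (- d) r0.
    move=> /(is_deriveZ (gamma `^ (d + 2))) h.
    by apply: (is_derive_eq h); rewrite /GRing.scale/= /c powRN; ring.
  have cE : gamma `^ (d + 2) * rho `^ (- d) = c by rewrite /c powRN.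
  have dEv : is_derive (gamma `^ (d + 2) * rho `^ (- d)) 1 (fine \o E)
     (derive1 (fine \o E) c) by rewrite cE.
  have h1 := @is_derive1_comp _ (fun y => y `^ d) (fun r => r / gamma) _ _ _
    (is_derive_powR_gt0 d rg0) du.
  have h2 := @is_derive1_comp _ (fine \o E)
    (fun r => gamma `^ (d + 2) * r `^ (- d)) _ _ _ dEv dv.
  have h : is_derive rho 1 (fun r => (r / gamma) `^ d *
    (fine \o E) (gamma `^ (d + 2) * r `^ (- d))) _ := is_deriveM h1 h2.
  rewrite derive1E (@derive_val _ _ _ _ _ _ _ h) /GRing.scale/= cE /e1 -/e0.
  by field; rewrite !gt_eqF.
have -> : (fun g => fine (N_ d E rho g)) =
    (fun g => (rho / g) `^ d * (fine \o E) ((rho `^ d)^-1 * g `^ (d + 2))).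
  by apply/funext => r; rewrite fineZ [(rho `^ d)^-1 * _]mulrC.
have du : is_derive gamma 1 (fun g => rho / g) (- rho / gamma ^+ 2).
  have gn0 : gamma != 0 by rewrite gt_eqF.
  have h : is_derive gamma 1 (fun g => rho / g) _ :=
    is_deriveZ rho (is_deriveV gn0 (is_derive_id gamma 1)).
  by apply: (is_derive_eq h); rewrite /GRing.scale/=; field.
have dv : is_derive gamma 1 (fun g => (rho `^ d)^-1 * g `^ (d + 2))
    ((d + 2) * c / gamma).
  have := is_derive_powR_gt0 (d + 2) g0.
  move=> /(is_deriveZ (rho `^ d)^-1) h.
  by apply: (is_derive_eq h); rewrite /GRing.scale/= /c; ring.
have cE : (rho `^ d)^-1 * gamma `^ (d + 2) = c by rewrite mulrC.
have dEv : is_derive ((rho `^ d)^-1 * gamma `^ (d + 2)) 1 (fine \o E)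
   (derive1 (fine \o E) c) by rewrite cE.
have h1 := @is_derive1_comp _ (fun y => y `^ d) (fun g => rho / g) _ _ _
  (is_derive_powR_gt0 d rg0) du.
have h2 := @is_derive1_comp _ (fine \o E)
  (fun g => (rho `^ d)^-1 * g `^ (d + 2)) _ _ _ dEv dv.
have h : is_derive gamma 1 (fun g => (rho / g) `^ d *
  (fine \o E) ((rho `^ d)^-1 * g `^ (d + 2))) _ := is_deriveM h1 h2.
rewrite derive1E (@derive_val _ _ _ _ _ _ _ h) /GRing.scale/= cE /e1 -/e0.
by field; rewrite !gt_eqF.
Qed.

Lemma condB_slope_ge (R : realType) (d : R) (E : R -> \bar R) :
  0 < d -> energy_density E -> condB d E <-> slope_ge (2 / (d + 2)) E.
Proof.
move=> d0 hE; have d2 : 0 < d + 2 by rewrite addr_gt0.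
have key rho gamma : 0 < rho -> 0 < gamma ->
    let c := gamma `^ (d + 2) / rho `^ d in (dom E)° c ->
    (0 <= (1 - 4 / d ^+ 2) * rho * derive1 (fun r => fine (N_ d E r gamma)) rho
         + gamma * derive1 (fun g => fine (N_ d E rho g)) gamma) =
    (2 / (d + 2) * fine (E c) <= c * derive1 (fine \o E) c).
  move=> r0 g0 c ic; have [Nr Ng] := N_gradient hE r0 g0 ic.
  rewrite -mulrA Nr Ng -[RHS]subr_ge0 -/c.
  (* the combination is this factor times c * E' c - 2 / (d + 2) * E c *)
  have k0 : 0 < (rho / gamma) `^ d * (2 * (d + 2) / d).
    by rewrite mulr_gt0 ?powR_gt0 ?divr_gt0// mulr_gt0.
  rewrite -[RHS](pmulr_rge0 _ k0); congr (_ <= _).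
  by field; rewrite !gt_eqF.
split=> [B c ic|sl rho gamma r0 g0 ic]; last by rewrite key//; exact: sl.
have c0 := interior_dom_gt0 ic.
have g0 : 0 < c `^ (d + 2)^-1 by rewrite powR_gt0.
have cE : (c `^ (d + 2)^-1) `^ (d + 2) / 1 `^ d = c.
  by rewrite -powRrM mulVf ?gt_eqF// powRr1 ?ltW// powR1 divr1.
have := B 1 _ ltr01 g0; rewrite key ?cE//; exact.
Qed.

(** * Consequence of the convexity of N *)

(** This is midpoint convexity of N between the points
    (e^(k(d+2)), g e^(kd)), k = h and k = -h, with g^(d+2) = c.  Both have
    gamma^(d+2) / rho^d = c, and N there is g^(-d) e^(2dk) E c. *)
Lemma N_midpoint (R : realType) (d : R) (E : R -> \bar R) (c h : R) :
  0 < d -> energy_density E ->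
  econvex_on quadrant (fun p : R^o * R^o => N_ d E p.1 p.2) ->
  0 < c -> dom E c ->
  let P := cosh ((d + 2) * h) in let Q := cosh (d * h) in
  let c' := c * (Q `^ (d + 2) / P `^ d) in
  dom E c' /\
  (P / Q) `^ d * fine (E c') <= cosh (2 * d * h) * fine (E c).
Proof.
move=> d0 hE cN c0 dc P Q c'; have d2 : 0 < d + 2 by rewrite addr_gt0.
have P0 : 0 < P := cosh_gt0 _; have Q0 : 0 < Q := cosh_gt0 _.
pose g := c `^ (d + 2)^-1; have g0 : 0 < g by rewrite powR_gt0.
have gc : g `^ (d + 2) = c by rewrite -powRrM mulVf ?gt_eqF// powRr1 ?ltW.
clearbody g.
have endpt k : N_ d E (expR ((d + 2) * k)) (g * expR (d * k)) =
    ((g `^ d)^-1 * expR (2 * d * k) * fine (E c))%:E.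
  rewrite EFinM (dom_fineK hE dc) /N_.
  rewrite -gc -(lnK g0).
  rewrite !(powR_expR, =^~ expRD, =^~ expRN).
  by congr ((_)%:E * E _)%E; congr expR; ring.
have quad k : quadrant ((expR ((d + 2) * k), g * expR (d * k)) : R^o * R^o).
  by split; rewrite ?mulr_gt0 ?expR_gt0.
have half : 0 <= (2^-1 : R) <= 1 by lra.
have := cN _ _ 2^-1 (quad h) (quad (- h)) half.
rewrite /= !endpt -!EFinM -EFinD.
have -> : (1 - 2^-1) *: (expR ((d + 2) * h) : R^o)
    + 2^-1 *: (expR ((d + 2) * - h) : R^o) = P.
  by rewrite /P /cosh /GRing.scale/= mulrN; field.
have -> : (1 - 2^-1) *: (g * expR (d * h) : R^o)
    + 2^-1 *: (g * expR (d * - h) : R^o) = g * Q.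
  by rewrite /Q /cosh /GRing.scale/= mulrN; field.
rewrite /N_.
have -> : (g * Q) `^ (d + 2) / P `^ d = c'.
  by rewrite powRM ?ltW// gc -mulrA.
have K0 : 0 < (P / (g * Q)) `^ d.
  by apply: powR_gt0; apply: divr_gt0 => //; exact: mulr_gt0.
have c'0 : 0 <= c'.
  apply: mulr_ge0; first exact: ltW.
  by apply: divr_ge0; exact: powR_ge0.
move=> le.
(* the midpoint value of N is bounded by a finite one *)
have dc' : dom E c'.
  split=> //; rewrite ltNge leye_eq; apply/negP => /eqP Ec'.
  by move: le; rewrite Ec' gt0_muley ?lte_fin// leye_eq.
split=> //; rewrite -(dom_fineK hE dc') -EFinM lee_fin in le; move: le.
have -> : P / (g * Q) = g^-1 * (P / Q) by field; rewrite !gt_eqF.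
have gd0 : 0 < (g `^ d)^-1 by rewrite invr_gt0 powR_gt0.
have -> : (g^-1 * (P / Q)) `^ d = (g `^ d)^-1 * (P / Q) `^ d.
  have gi0 : 0 <= g^-1 by rewrite invr_ge0 ltW.
  have PQ0 : 0 <= P / Q by apply: divr_ge0; exact: ltW.
  rewrite (powRM _ gi0 PQ0); congr (_ * _).
  by rewrite -powR_inv1 ?ltW// -powRrM mulN1r powRN.
rewrite -[in X in _ -> X](ler_pM2l gd0).
by congr (_ <= _); rewrite /cosh ?mulrN; field; rewrite gt_eqF// powR_gt0.
Qed.

(** With A, B, Q as in the proof, [N_midpoint] and the tangent inequality give
    0 <= e0 * (A - B) + e1 * (B - Q^2), where all of A, B, Q^2 equal 1 at
    h = 0.  Their coefficients of order h^2 are 2 d^2, 2 d^2 + 2 d and d^2, which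
    leaves (d^2 + 2 d) e1 - 2 d e0 >= 0. *)
Lemma econvex_N_slope_ge (R : realType) (d : R) (E : R -> \bar R) :
  0 < d -> energy_density E ->
  econvex_on quadrant (fun p : R^o * R^o => N_ d E p.1 p.2) ->
  slope_ge (2 / (d + 2)) E.
Proof.
move=> d0 hE cN c ic; have d2 : 0 < d + 2 by rewrite addr_gt0.
have c0 := interior_dom_gt0 ic; have dc := interior_subset ic.
set e0 := fine (E c); set e1 := c * _.
pose A h := cosh (2 * d * h); pose P h := cosh ((d + 2) * h).
pose Q h := cosh (d * h); pose B h := P h `^ d * Q h `^ (- d).
have ineq h : 0 <= e0 * (A h - B h) + e1 * (B h - Q h * Q h).
  have [dc' le] := N_midpoint h d0 hE cN c0 dc.
  have := tangent_le hE ic dc'.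
  set r := Q h `^ (d + 2) / P h `^ d in dc' le *.
  have P0 : 0 < P h := cosh_gt0 _; have Q0 : 0 < Q h := cosh_gt0 _.
  have B0 : 0 < B h by rewrite mulr_gt0 ?powR_gt0.
  have BE : (P h / Q h) `^ d = B h.
    rewrite /B powRM ?invr_ge0 ?ltW//; congr (_ * _).
    by rewrite -powR_inv1 ?ltW// -powRrM mulN1r.
  rewrite BE in le.
  (* B and r contain opposite powers of P, and Q^(-d) * Q^(d+2) = Q^2 *)
  have rB : B h * r = Q h * Q h.
    rewrite /B /r powRD ?gt_eqF ?implybT// powRN.
    have -> : Q h `^ 2 = Q h * Q h by rewrite (powR_mulrn 2) ?ltW.
    by field; rewrite !gt_eqF ?powR_gt0.
  rewrite -(ler_pM2l B0) => /le_trans/(_ le).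
  rewrite -subr_ge0 -rB; congr (_ <= _); rewrite /e0 /e1 /A; ring.
have qP : quad_cvg P ((d + 2) ^+ 2 / 2) := @quad_cvg_cosh R _.
have qQ : quad_cvg Q (d ^+ 2 / 2) := @quad_cvg_cosh R _.
have qA : quad_cvg A ((2 * d) ^+ 2 / 2) := @quad_cvg_cosh R _.
have qpow (u : R -> R) a p : quad_cvg u a -> quad_cvg (fun h => u h `^ p) (p * a).
  apply: (@quad_cvg_comp _ (fun x => x `^ p)); first by rewrite powR1.
  have := is_derive_powR_gt0 p (@ltr01 R).
  by rewrite powR1 mulr1 divr1.
have qB := quad_cvgM (qpow _ _ d qP) (qpow _ _ (- d) qQ).
have qQQ := quad_cvgM qQ qQ.
set aB := (X in quad_cvg _ X) in qB; set aQQ := (X in quad_cvg _ X) in qQQ.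
pose aA := (2 * d) ^+ 2 / 2.
have lim0 : (fun h => e0 * ((A h - 1) / h ^+ 2 - (B h - 1) / h ^+ 2) +
    e1 * ((B h - 1) / h ^+ 2 - (Q h * Q h - 1) / h ^+ 2)) @ 0^' -->
  e0 * (aA - aB) + e1 * (aB - aQQ).
  apply: cvgD; apply: cvgM; try exact: cvg_cst; exact: cvgB.
rewrite -subr_ge0 -(pmulr_rge0 _ (mulr_gt0 d0 d2)).
have -> : d * (d + 2) * (e1 - 2 / (d + 2) * e0) =
    e0 * (aA - aB) + e1 * (aB - aQQ).
  by rewrite /aA /aB /aQQ; field; rewrite gt_eqF.
apply: (cvgr_to_ge lim0); near=> h.
have -> : e0 * ((A h - 1) / h ^+ 2 - (B h - 1) / h ^+ 2) +
    e1 * ((B h - 1) / h ^+ 2 - (Q h * Q h - 1) / h ^+ 2) =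
    (e0 * (A h - B h) + e1 * (B h - Q h * Q h)) / h ^+ 2 by ring.
by rewrite divr_ge0 ?sqr_ge0.
Unshelve. all: by end_near. Qed.

(** * The three conditions *)

Theorem proposition6p2 (R : realType) (d : R) (E : R -> \bar R)
    (hd : 1 <= d) (hE : energy_density E) :
  ((condA d E <-> condB d E) /\ (condB d E <-> condC d E)) /\
  (econvex_on quadrant (fun p : R^o * R^o => N_ d E p.1 p.2) ->
   (forall gamma : R, 0 < gamma ->
      enonincreasing_pos (fun rho => ((d - 1)%:E * N_ d E rho gamma)%E)) ->
   [/\ condA d E, condB d E & condC d E]).
Proof.
have d0 : 0 < d := lt_le_trans ltr01 hd.
have AS : condA d E <-> slope_ge (2 / (d + 2)) E := slope_geP _ hE.
have BS := condB_slope_ge d0 hE.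
have AC := condA_condC E d0.
split; first by tauto.
move=> cN _; have sl := econvex_N_slope_ge d0 hE cN.
by split; tauto.
Qed.
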